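(* Let $C=\varphi^2(1+\varphi^{-1/2})$ and let $S_n=\sum_{i=1}^n\sqrt{F_i}$ be the initial external perimeter of the Fibonacci--Theodorus spiral formed with exactly $n$ triangles. For every integer $n>1$, $$\left|S_n-C\left(\sqrt{F_n}-\frac{1}{\sqrt[4]{5}}\right)\right|\le 1 .$$
   Context: $F_n$ denotes the $n$-th Fibonacci number: $F_1=F_2=1$ and $F_{n+1}=F_n+F_{n-1}$ for $n\ge 2$. $\varphi=(1+\sqrt5)/2$. The $i$-th triangle of the Fibonacci--Theodorus spiral is the right triangle with legs $\sqrt{F_{i+1}}$ (adjacent to the common vertex of the spiral) and $\sqrt{F_i}$ (the outer side, opposite to the common vertex) and hypotenuse $\sqrt{F_{i+2}}$; the initial external perimeter $S_n$ is the sum of the lengths of the outer sides of the first $n$ triangles. *)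

(* Defs.v *)
From Stdlib Require Import Reals.
From Coquelicot Require Import Coquelicot.
Open Scope R_scope.

(** The Fibonacci numbers, with the extra value [fib 0 = 0], so that
    [fib 1 = fib 2 = 1] and [fib (n + 1) = fib n + fib (n - 1)] for [n >= 2]. *)
Fixpoint fib (n : nat) : nat :=
  match n with
  | O => 0
  | S m => match m with
           | O => 1
           | S k => fib m + fib k
           end
  end.

Definition phi : R := (1 + sqrt 5) / 2.

(** The [i]-th triangle of the spiral ([i >= 1]) has legs [sqrt F_(i+1)]
    (adjacent to the common vertex) and [sqrt F_i] (opposite to it). *)
Definition outer_side (i : nat) : R := sqrt (INR (fib i)).

Definition initial_external_perimeter (n : nat) : R := sum_n_m outer_side 1 n.

Definition perimeter_const : R := phi ^ 2 * (1 + Rpower phi (- (1 / 2))).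

(* Main.v *)
(** Put r = 1/phi, s = sqrt r and C = phi^2 (1 + s) = 1 / (1 - s), and let E_n be
    the quantity inside the absolute value.  Then
    E_(n+1) - E_n = C (sqrt F_n - s sqrt F_(n+1)).  Multiplying by the conjugate
    and using F_n - r F_(n+1) = (-r)^(n+1), this difference is at most
    r^(n-1) / sqrt 2 in absolute value for n >= 3.  Since r^2 = 1 - r, these
    bounds sum to 1 / sqrt 2, and |E_3| < 0.29. *)
Require Import Defs.
From Stdlib Require Import Reals Lra Lia.
From Coquelicot Require Import Coquelicot.
Open Scope R_scope.

Lemma phi_pos : 0 < phi.
Proof. unfold phi; pose proof (sqrt_pos 5); lra. Qed.

Lemma phi_sqr : phi ^ 2 = phi + 1.
Proof.
  unfold phi; pose proof (sqrt_sqrt 5 ltac:(lra)); nra.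
Qed.

Lemma inv_phi_pos : 0 < / phi.
Proof. apply Rinv_0_lt_compat, phi_pos. Qed.

Lemma inv_phi_sqr : / phi * / phi = 1 - / phi.
Proof.
  pose proof phi_pos; pose proof phi_sqr.
  apply Rmult_eq_reg_l with (phi ^ 2); [|nra].
  field_simplify; lra.
Qed.

Lemma inv_phi_bounds : 0.618 <= / phi <= 0.6181.
Proof. pose proof inv_phi_pos; pose proof inv_phi_sqr; split; nra. Qed.

Lemma Rpower_neg_half (x : R) : 0 < x -> Rpower x (- (1 / 2)) = sqrt (/ x).
Proof.
  intros hx.
  replace (1 / 2) with (/ 2) by lra.
  rewrite Rpower_Ropp, Rpower_sqrt, sqrt_inv by assumption; reflexivity.
Qed.

Lemma Rpower_quarter (x : R) : 0 < x -> Rpower x (1 / 4) ^ 4 = x.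
Proof.
  intros hx.
  rewrite <- Rpower_pow by apply exp_pos.
  rewrite Rpower_mult.
  replace (1 / 4 * INR 4) with 1 by (simpl; lra).
  now apply Rpower_1.
Qed.

Lemma inv_Rpower_5_quarter_bounds : 0.668 <= 1 / Rpower 5 (1 / 4) <= 0.669.
Proof.
  assert (hpos : 0 < Rpower 5 (1 / 4)) by apply exp_pos.
  assert (h4 := Rpower_quarter 5 ltac:(lra)).
  set (q := 1 / Rpower 5 (1 / 4)).
  assert (hq : 0 < q) by (apply Rdiv_lt_0_compat; lra).
  assert (hq4 : (q * q) * (q * q) = / 5).
  (* The first four occurrences of 5 sit inside the copies of [q]; the fifth is the one on the
     right-hand side. *)
  { unfold q; rewrite <- h4 at 5; field; lra. }
  assert (hqq : 0.4472 <= q * q <= 0.4473) by (split; nra).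
  split; nra.
Qed.

Lemma sqrt_inv_phi_bounds : 0.786 <= sqrt (/ phi) <= 0.787.
Proof.
  pose proof inv_phi_bounds.
  pose proof (sqrt_pos (/ phi)); pose proof (sqrt_sqrt (/ phi) ltac:(lra)).
  split; nra.
Qed.

Lemma sqrt_2_bounds : 1.414 <= sqrt 2 <= 1.415.
Proof.
  pose proof (sqrt_pos 2); pose proof (sqrt_sqrt 2 ltac:(lra)); split; nra.
Qed.

Lemma perimeter_const_eq : perimeter_const = phi ^ 2 * (1 + sqrt (/ phi)).
Proof. unfold perimeter_const; now rewrite Rpower_neg_half by apply phi_pos. Qed.

(** With s^2 = 1/phi, the product is phi^2 (1 - s^2) = phi^2 - phi = 1. *)
Lemma perimeter_const_mul : perimeter_const * (1 - sqrt (/ phi)) = 1.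
Proof.
  rewrite perimeter_const_eq.
  pose proof phi_pos; pose proof phi_sqr; pose proof inv_phi_pos.
  pose proof (sqrt_sqrt (/ phi) ltac:(lra)) as hss.
  replace (_ * _ * _) with (phi ^ 2 * (1 - sqrt (/ phi) * sqrt (/ phi))) by ring.
  rewrite hss; field_simplify; lra.
Qed.

Lemma perimeter_const_bounds : 4.67 <= perimeter_const <= 4.70.
Proof.
  pose proof perimeter_const_mul; pose proof sqrt_inv_phi_bounds; split; nra.
Qed.

Lemma fib_SS (n : nat) : fib (S (S n)) = (fib (S n) + fib n)%nat.
Proof. reflexivity. Qed.

(** Each step multiplies the left side by -r, where r = 1/phi: F_(n+1) - r F_(n+2) = (1 - r) F_(n+1)
    - r F_n, and 1 - r = r^2. *)
Lemma fib_sub_inv_phi (n : nat) :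
  INR (fib n) - / phi * INR (fib (S n)) = (- / phi) ^ S n.
Proof.
  induction n as [|n IH]; [simpl; lra|].
  rewrite <- tech_pow_Rmult, <- IH, fib_SS, plus_INR.
  transitivity ((1 - / phi) * INR (fib (S n)) - / phi * INR (fib n)); [ring|].
  rewrite <- inv_phi_sqr; ring.
Qed.

(** From index 3 on, this bounds the conjugate sqrt F_n + s sqrt F_(n+1) below by sqrt 2 (1 + s),
    whose factor 1 + s absorbs the one in C. *)
Lemma fib_ge_2 (k : nat) : (2 <= fib (3 + k))%nat.
Proof.
  induction k as [|k IH]; [simpl; lia|].
  replace (3 + S k)%nat with (S (S (S (S k)))) by lia.
  rewrite fib_SS; cbn [Nat.add] in IH; lia.
Qed.

Lemma sqrt_fib_ge (k : nat) : sqrt 2 <= sqrt (INR (fib (3 + k))).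
Proof. apply sqrt_le_1_alt; apply (le_INR 2), fib_ge_2. Qed.

Definition perimeter_error (n : nat) : R :=
  initial_external_perimeter n
  - perimeter_const * (sqrt (INR (fib n)) - 1 / Rpower 5 (1 / 4)).

Lemma perimeter_S (n : nat) :
  initial_external_perimeter (S n)
  = initial_external_perimeter n + sqrt (INR (fib (S n))).
Proof.
  unfold initial_external_perimeter; now rewrite sum_n_Sm by lia.
Qed.

Lemma perimeter_error_S (n : nat) :
  perimeter_error (S n) - perimeter_error n
  = perimeter_const
    * (sqrt (INR (fib n)) - sqrt (/ phi) * sqrt (INR (fib (S n)))).
Proof.
  unfold perimeter_error; rewrite perimeter_S.
  (* The new side is written as C (1 - s) sqrt F_(n+1), so that the terms C sqrt F_(n+1) cancel. *)
  rewrite <- (Rmult_1_l (sqrt (INR (fib (S n))))) at 1.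
  rewrite <- perimeter_const_mul; ring.
Qed.

Lemma perimeter_error_step (k : nat) :
  sqrt 2 * Rabs (perimeter_error (S (3 + k)) - perimeter_error (3 + k))
  <= (/ phi) ^ S (S k).
Proof.
  rewrite perimeter_error_S, perimeter_const_eq.
  pose proof phi_pos as hphi.
  pose proof inv_phi_pos as hr.
  pose proof sqrt_inv_phi_bounds as hs.
  pose proof (sqrt_sqrt (/ phi) ltac:(lra)) as hss.
  pose proof sqrt_2_bounds as h2.
  pose proof (sqrt_fib_ge k) as ha.
  pose proof (sqrt_fib_ge (S k)) as hb.
  replace (3 + S k)%nat with (S (3 + k)) in hb by lia.
  pose proof (fib_sub_inv_phi (3 + k)) as hf.
  rewrite <- (sqrt_sqrt (INR (fib (3 + k)))) in hf by apply pos_INR.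
  rewrite <- (sqrt_sqrt (INR (fib (S (3 + k))))) in hf by apply pos_INR.
  set (a := sqrt (INR (fib (3 + k)))) in *.
  set (b := sqrt (INR (fib (S (3 + k))))) in *.
  set (s := sqrt (/ phi)) in *.
  (* Multiplying by the conjugate gives a^2 - s^2 b^2 = F_n - r F_(n+1) with n = 3 + k, a signed
     power of r. *)
  assert (hd : Rabs (a - s * b) * (a + s * b) = (/ phi) ^ S (3 + k)).
  { rewrite <- (Rabs_pos_eq (a + s * b)) by nra.
    rewrite <- Rabs_mult.
    replace ((a - s * b) * (a + s * b)) with (a * a - / phi * (b * b))
      by (rewrite <- hss; ring).
    rewrite hf, <- RPow_abs, Rabs_Ropp, Rabs_pos_eq by lra; reflexivity. }
  rewrite Rabs_mult, (Rabs_pos_eq (phi ^ 2 * (1 + s))) by nra.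
  replace ((/ phi) ^ S (S k)) with (phi ^ 2 * (/ phi) ^ S (3 + k))
    by (simpl; field; lra).
  rewrite <- hd.
  replace (sqrt 2 * (phi ^ 2 * (1 + s) * Rabs (a - s * b)))
    with (phi ^ 2 * (Rabs (a - s * b) * (sqrt 2 * (1 + s)))) by ring.
  apply Rmult_le_compat_l; [nra|].
  (* What remains is sqrt 2 (1 + s) <= a + s b, which follows from a, b >= sqrt 2. *)
  apply Rmult_le_compat_l; [apply Rabs_pos|nra].
Qed.

Lemma perimeter_error_sub_3 (k : nat) :
  sqrt 2 * Rabs (perimeter_error (3 + k) - perimeter_error 3)
  <= 1 - (/ phi) ^ k.
Proof.
  induction k as [|k IH].
  - cbn [Nat.add pow]; rewrite Rminus_diag, Rabs_R0; lra.
  - pose proof (perimeter_error_step k) as hstep.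
    (* By r^2 = 1 - r the step bound is a difference of consecutive powers, so the sum
       telescopes. *)
    replace ((/ phi) ^ S (S k)) with ((/ phi) ^ k - (/ phi) ^ S k) in hstep
      by (simpl; rewrite <- Rmult_assoc, inv_phi_sqr; ring).
    replace (3 + S k)%nat with (S (3 + k)) by lia.
    pose proof (Rabs_triang
      (perimeter_error (S (3 + k)) - perimeter_error (3 + k))
      (perimeter_error (3 + k) - perimeter_error 3)) as htri.
    replace (_ - _ + (_ - _))
      with (perimeter_error (S (3 + k)) - perimeter_error 3) in htri by ring.
    pose proof sqrt_2_bounds; nra.
Qed.

Lemma perimeter_error_2_eq :
  perimeter_error 2 = 2 - perimeter_const * (1 - 1 / Rpower 5 (1 / 4)).
Proof.
  unfold perimeter_error; rewrite perimeter_S.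
  unfold initial_external_perimeter; rewrite sum_n_n; unfold outer_side.
  cbn [fib Nat.add INR]; rewrite sqrt_1; ring.
Qed.

(** Since F_2 = 1 is below the bound of [fib_ge_2], this index is settled numerically. *)
Lemma perimeter_error_2 : Rabs (perimeter_error 2) <= 1.
Proof.
  rewrite perimeter_error_2_eq.
  pose proof perimeter_const_bounds; pose proof inv_Rpower_5_quarter_bounds.
  apply Rabs_le; split; nra.
Qed.

(** The constant 0.29 is chosen just below 1 - 1 / sqrt 2 = 0.2928..., the room left by the
    telescoped bound. *)
Lemma perimeter_error_3 : Rabs (perimeter_error 3) <= 0.29.
Proof.
  assert (h : perimeter_error 3
    = 2 + sqrt 2 - perimeter_const * (sqrt 2 - 1 / Rpower 5 (1 / 4))).
  { pose proof perimeter_error_2_eq as h2.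
    unfold perimeter_error in *; rewrite perimeter_S.
    cbn [fib Nat.add INR] in *; rewrite sqrt_1 in h2.
    replace (1 + 1) with 2 by ring; lra. }
  rewrite h.
  pose proof perimeter_const_bounds; pose proof inv_Rpower_5_quarter_bounds.
  pose proof sqrt_2_bounds.
  apply Rabs_le; split; nra.
Qed.

Theorem theorem3p1 (n : nat) (hn : (1 < n)%nat) :
  Rabs (initial_external_perimeter n
        - perimeter_const * (sqrt (INR (fib n)) - 1 / Rpower 5 (1 / 4))) <= 1.
Proof.
  change (Rabs (perimeter_error n) <= 1).
  destruct (Nat.eq_dec n 2) as [->|hn2]; [exact perimeter_error_2|].
  replace n with (3 + (n - 3))%nat by lia.
  set (k := (n - 3)%nat).
  pose proof (perimeter_error_sub_3 k) as hk.
  pose proof (pow_lt (/ phi) k inv_phi_pos).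
  pose proof perimeter_error_3; pose proof sqrt_2_bounds.
  pose proof (Rabs_triang (perimeter_error (3 + k) - perimeter_error 3)
    (perimeter_error 3)) as htri.
  replace (_ - _ + _) with (perimeter_error (3 + k)) in htri by ring.
  (* The drift from index 3 is below 1 / 1.414 < 0.71, and 0.71 + 0.29 = 1. *)
  nra.
Qed.
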